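(* Let $M$ be a hyperkähler manifold with an $\mathcal{O}(2j-2)$-twisted rotational action relative to the 3-axis. The generator $X^\star_0$ in a canonical presentation $\{X^\star_n\}$ of the action is a vector field of quasi-rotational type relative to the same axis, with $$\sigma_+=i\,\mathcal{L}_{X^\star_+}\omega_0=i\,d(\iota_{X^\star_+}\omega_0),$$ where $X^\star_+=X^\star_1$.
   Context: A hyperkähler manifold is a smooth manifold $M$ of real dimension $4m$ with three symplectic forms $\omega_1,\omega_2,\omega_3$ such that, viewing 2-forms as bundle maps $TM\to T^*M$, the endomorphisms $I_1=\omega_3^{-1}\omega_2$, $I_2=\omega_1^{-1}\omega_3$, $I_3=\omega_2^{-1}\omega_1$ satisfy $I_1^2=I_2^2=I_3^2=I_1I_2I_3=-1$; the metric $g$ is given by $\omega_i(X,Y)=g(X,I_iY)$. Put $I_+=\tfrac12(I_1+iI_2)$, $I_0=I_3$, $I_-=-\tfrac12(I_1-iI_2)$, $\omega_+=\tfrac12(\omega_1+i\omega_2)$, $\omega_0=\omega_3$, $\omega_-=-\tfrac12(\omega_1-i\omega_2)$, and $\omega_n=0$ for $|n|>1$. For an integer $j>1$ (with $j=1$, a rotational vector field, allowed as a limit case), an $\mathcal{O}(2j-2)$-twisted rotational action relative to the 3-axis is generated by vector fields $X_n\in T_{\mathbb{C}}M$, $1-j\le n\le j-1$ (with $X_n=0$ for other $n$), satisfying $\bar X_n=(-1)^nX_{-n}$ and $\mathcal{L}_{X_{n-1}}\omega_++\mathcal{L}_{X_n}\omega_0+\mathcal{L}_{X_{n+1}}\omega_-=-i\,n\,\omega_n$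 for all $n\in\mathbb{Z}$. Generators are considered up to redefinitions $X_n\mapsto X_n+I_+Y_{n-1}+I_0Y_n+I_-Y_{n+1}$ with $Y_n\in T_{\mathbb{C}}M$, $2-j\le n\le j-2$, $\bar Y_n=(-1)^nY_{-n}$, which preserve these conditions. A canonical presentation $\{X^\star_n\}$ is a choice of representative such that $X^\star_n$ is a section of $T^{1,0}_{I_0}M$ for $n>0$ and of $T^{0,1}_{I_0}M$ for $n<0$; such a choice always exists. A (real) vector field $X$ is quasi-rotational relative to the 3-axis if there exists a complex-valued 2-form $\sigma_+$ on $M$ of type $(1,1)$ with respect to $I_3\equiv I_0$ such that $\mathcal{L}_X\omega_\pm=\mp i(\omega_\pm-\sigma_\pm)$ and $\mathcal{L}_X\omega_0=0$, where $\sigma_-=-\bar\sigma_+$. *)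

(* Defs.v *)
From HB Require Import structures.
From mathcomp Require Import all_boot all_order all_algebra.
From mathcomp Require Import all_classical all_reals all_analysis.
From mathcomp Require Import complex.
From mathcomp Require Import ring.
Import Order.TTheory GRing.Theory Num.Theory.
Import numFieldNormedType.Exports.

Set Implicit Arguments.
Unset Strict Implicit.
Unset Printing Implicit Defensive.

Local Open Scope classical_set_scope.
Local Open Scope ring_scope.

Section smooth_on.
Variables (R : realType) (n : nat).
Implicit Types (k : nat) (U : set 'rV[R]_n) (f g : 'rV[R]_n -> R).

(* Partial derivatives up to order k exist and are continuous on U; when U is
   open, only the restriction of f to U matters. *)
Fixpoint Ck_on k U f : Prop :=
  (forall x, U x -> {for x, continuous f}) /\
  if k is k'.+1 then
    forall i : 'I_n, (forall x, U x -> derivable f x (delta_mx 0 i)) /\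
      Ck_on k' U (fun x => 'D_(delta_mx 0 i) f x)
  else True.

Definition Cinfty_on U f : Prop := forall k, Ck_on k U f.

Lemma Ck_on_continuous k U f :
  Ck_on k U f -> forall x, U x -> {for x, continuous f}.
Proof. by case: k => [|k] []. Qed.

Lemma Ck_on_pred k U f : Ck_on k.+1 U f -> Ck_on k U f.
Proof.
elim: k f => [|k IH] f [cf Df]; split => // i.
by have [df /IH] := Df i.
Qed.

Lemma Ck_on_eq k U f g : open U -> {in U, f =1 g} ->
  Ck_on k U f -> Ck_on k U g.
Proof.
move=> oU.
have near_eq (h h' : 'rV[R]_n -> R) x :
    {in U, h =1 h'} -> U x -> {near x, h =1 h'}.
  by move=> hh' Ux; near=> y; apply/hh'/mem_set; near: y;
    exact: open_nbhs_nbhs.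
have cts_eq (h h' : 'rV[R]_n -> R) : {in U, h =1 h'} ->
    (forall x, U x -> {for x, continuous h}) ->
    forall x, U x -> {for x, continuous h'}.
  move=> hh' ch x Ux; have := ch x Ux.
  rewrite /prop_for /continuous_at -(hh' x (mem_set Ux)) => hx.
  exact: cvg_trans (near_eq_cvg (near_eq _ _ _ hh' Ux)) hx.
elim: k f g => [|k IH] f g fg Cf.
  by split => // x; apply: cts_eq fg _ _; exact: Ck_on_continuous Cf.
split=> [x|i].
  by apply: cts_eq fg _ _; exact: Ck_on_continuous Cf.
have [df Cdf] := Cf.2 i.
split=> [x Ux|]; first exact: near_eq_derivable (near_eq _ _ _ fg Ux) (df x Ux).
apply: IH Cdf => x /set_mem Ux.
exact: near_eq_derive (near_eq _ _ _ fg Ux).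
Unshelve. all: by end_near. Qed.

Lemma Ck_on_cst k U (c : R) : Ck_on k U (cst c).
Proof.
elim: k c => [|k IH] c; (split=> [x _|]; first exact: cst_continuous) => //.
move=> i; split=> [x _|]; first exact: derivable_cst.
by under eq_fun do rewrite derive_cst; exact: IH.
Qed.

Lemma Ck_onD k U f g : open U ->
  Ck_on k U f -> Ck_on k U g -> Ck_on k U (f + g).
Proof.
move=> oU; elim: k f g => [|k IH] f g Cf Cg.
all: split=> [x Ux|//].
1,2: exact: continuousD (Ck_on_continuous Cf Ux) (Ck_on_continuous Cg Ux).
move=> i; have [df Cdf] := Cf.2 i; have [dg Cdg] := Cg.2 i.
split=> [x Ux|]; first exact: derivableD (df x Ux) (dg x Ux).
apply: Ck_on_eq (IH _ _ Cdf Cdg) => // x /set_mem Ux.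
by rewrite deriveD; [|exact: df|exact: dg].
Qed.

Lemma Ck_onM k U f g : open U ->
  Ck_on k U f -> Ck_on k U g -> Ck_on k U (f * g).
Proof.
move=> oU; elim: k f g => [|k IH] f g Cf Cg.
all: split=> [x Ux|//].
1,2: exact: continuousM (Ck_on_continuous Cf Ux) (Ck_on_continuous Cg Ux).
move=> i; have [df Cdf] := Cf.2 i; have [dg Cdg] := Cg.2 i.
split=> [x Ux|]; first exact: derivableM (df x Ux) (dg x Ux).
have := Ck_onD oU (IH _ _ (Ck_on_pred Cf) Cdg) (IH _ _ (Ck_on_pred Cg) Cdf).
apply: Ck_on_eq => // x /set_mem Ux.
by rewrite deriveM; [|exact: df|exact: dg].
Qed.

Lemma Ck_onN k U f : open U -> Ck_on k U f -> Ck_on k U (- f).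
Proof.
rewrite (_ : - f = cst (-1) * f); last by apply/funext => x; rewrite !fctE mulN1r.
by move=> oU; apply: Ck_onM => //; exact: Ck_on_cst.
Qed.

End smooth_on.

Section manifold.
Variables (R : realType) (n : nat).

Record chart (T : topologicalType) := Chart {
  chart_dom : set T;
  chart_cod : set 'rV[R]_n;
  chart_fun : T -> 'rV[R]_n;
  chart_inv : 'rV[R]_n -> T;
  chart_dom_open : open chart_dom;
  chart_cod_open : open chart_cod;
  chart_funS : forall p, chart_dom p -> chart_cod (chart_fun p);
  chart_invS : forall x, chart_cod x -> chart_dom (chart_inv x);
  chart_funK : forall p, chart_dom p -> chart_inv (chart_fun p) = p;
  chart_invK : forall x, chart_cod x -> chart_fun (chart_inv x) = x;
  chart_fun_continuous :
    forall p, chart_dom p -> {for p, continuous chart_fun};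
  chart_inv_continuous :
    forall x, chart_cod x -> {for x, continuous chart_inv}
}.

Definition compatible_charts (T : topologicalType) (c c' : chart T) : Prop :=
  forall i : 'I_n,
    Cinfty_on (chart_cod c `&` chart_inv c @^-1` chart_dom c')
              (fun x => chart_fun c' (chart_inv c x) 0 i).

(* The atlas need not be maximal. *)
Record smooth_manifold := SmoothManifold {
  mfd_carrier :> topologicalType;
  mfd_hausdorff : hausdorff_space mfd_carrier;
  mfd_second_countable : @second_countable mfd_carrier;
  mfd_atlas : set (chart mfd_carrier);
  mfd_cover : forall p, exists2 c, mfd_atlas c & chart_dom c p;
  mfd_compatible :
    forall c c', mfd_atlas c -> mfd_atlas c' -> compatible_charts c c'
}.

Variable M : smooth_manifold.

Definition smooth_real (f : M -> R) : Prop :=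
  forall c, mfd_atlas c -> Cinfty_on (chart_cod c) (f \o chart_inv c).

Definition smooth_complex (f : M -> R[i]) : Prop :=
  smooth_real (fun p => complex.Re (f p)) /\ smooth_real (fun p => complex.Im (f p)).

Lemma smooth_realD f g :
  smooth_real f -> smooth_real g -> smooth_real (f + g).
Proof.
move=> sf sg c Mc k; exact: (Ck_onD (chart_cod_open (c:=c)) (sf c Mc k) (sg c Mc k)).
Qed.

Lemma smooth_realM f g :
  smooth_real f -> smooth_real g -> smooth_real (f * g).
Proof.
move=> sf sg c Mc k; exact: (Ck_onM (chart_cod_open (c:=c)) (sf c Mc k) (sg c Mc k)).
Qed.

Lemma smooth_realN f : smooth_real f -> smooth_real (- f).
Proof.
by move=> sf c Mc k; exact: (Ck_onN (chart_cod_open (c:=c)) (sf c Mc k)).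
Qed.

Lemma smooth_real_cst (r : R) : smooth_real (cst r).
Proof. by move=> c _ k; exact: Ck_on_cst. Qed.

Definition smooth_pred : pred (M -> R[i]) := fun f => `[< smooth_complex f >].

Lemma smooth_pred_cst (z : R[i]) : (cst z : M -> R[i]) \in smooth_pred.
Proof. by apply/asboolP; split; exact: smooth_real_cst. Qed.

Lemma smooth_predB : {in smooth_pred &, forall f g, f - g \in smooth_pred}.
Proof.
move=> f g /asboolP[fr fi] /asboolP[gr gi]; apply/asboolP; split.
- rewrite (_ : (fun _ => _) = (fun p => complex.Re (f p)) + - (fun p => complex.Re (g p))).
    exact/smooth_realD/smooth_realN.
  by apply/funext => p /=; rewrite raddfB.
- rewrite (_ : (fun _ => _) = (fun p => complex.Im (f p)) + - (fun p => complex.Im (g p))).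
    exact/smooth_realD/smooth_realN.
  by apply/funext => p /=; rewrite raddfB.
Qed.

Lemma smooth_predM : {in smooth_pred &, forall f g, f * g \in smooth_pred}.
Proof.
move=> f g /asboolP[fr fi] /asboolP[gr gi]; apply/asboolP; split.
- rewrite (_ : (fun _ => _) = (fun p => complex.Re (f p)) * (fun p => complex.Re (g p))
              + - ((fun p => complex.Im (f p)) * (fun p => complex.Im (g p)))).
    by apply/smooth_realD; [|apply/smooth_realN]; exact: smooth_realM.
  by apply/funext => p; rewrite !fctE; case: (f p) (g p) => [a b] [c d].
- rewrite (_ : (fun _ => _) = (fun p => complex.Re (f p)) * (fun p => complex.Im (g p))
              + (fun p => complex.Im (f p)) * (fun p => complex.Re (g p))).
    by apply/smooth_realD; exact: smooth_realM.
  by apply/funext => p; rewrite !fctE; case: (f p) (g p) => [a b] [c d].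
Qed.

Lemma smooth_pred_subring : subring_closed smooth_pred.
Proof.
by split; [exact: smooth_pred_cst|exact: smooth_predB|exact: smooth_predM].
Qed.

Record smooth_function := SmoothFunction {
  smooth_fun :> M -> R[i];
  smooth_funP : smooth_fun \in smooth_pred
}.
HB.instance Definition _ := [isSub for smooth_fun].
HB.instance Definition _ := [Choice of smooth_function by <:].
HB.instance Definition _ :=
  GRing.SubChoice_isSubComPzRing.Build _ _ smooth_function smooth_pred_subring.

End manifold.

Section calculus.
Variables (R : realType) (n : nat) (M : smooth_manifold R n).
Local Notation C := R[i].
Local Notation A := (smooth_function M).

Definition const_smooth (z : C) : A :=
  SmoothFunction (smooth_pred_cst M z).

Lemma smooth_pred_conj (f : A) : (fun p => (f p)^*%C) \in @smooth_pred _ _ M.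
Proof.
have /asboolP[fr fi] := smooth_funP f; apply/asboolP; split.
  by rewrite (_ : (fun _ => _) = (fun p => complex.Re (f p)))//;
    apply/funext => p; case: (f p).
rewrite (_ : (fun _ => _) = - (fun p => complex.Im (f p))).
  exact: smooth_realN.
by apply/funext => p; rewrite !fctE; case: (f p).
Qed.

Definition conj_smooth (f : A) : A := SmoothFunction (smooth_pred_conj f).

(* Smooth sections of the complexified tangent bundle, identified with the
   C-linear derivations of the algebra of complex-valued smooth functions.  The
   real vector fields are those fixed by [conj_vf] below. *)
Record vector_field := VectorField {
  vf_fun :> A -> A;
  vf_linear : forall (z : C) f g,
    vf_fun (const_smooth z * f + g) = const_smooth z * vf_fun f + vf_fun g;
  vf_leibniz : forall f g, vf_fun (f * g) = vf_fun f * g + f * vf_fun g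
}.

Lemma vf_ext (X Y : vector_field) : X =1 Y -> X = Y.
Proof.
case: X Y => [X X1 X2] [Y Y1 Y2] /= /funext XY; rewrite XY in X1 X2 *.
by congr VectorField; exact: Prop_irrelevance.
Qed.

Lemma const_smooth1 : const_smooth 1 = 1.
Proof. exact/val_inj. Qed.

Lemma vfD (X : vector_field) f g : X (f + g) = X f + X g.
Proof. by have := vf_linear X 1 f g; rewrite const_smooth1 !mul1r. Qed.

Lemma vf0 (X : vector_field) : X 0 = 0.
Proof. by apply: (@addrI _ (X 0)); rewrite -vfD !addr0. Qed.

Lemma vfN (X : vector_field) f : X (- f) = - X f.
Proof. by apply/eqP; rewrite -addr_eq0 -vfD addNr vf0. Qed.

Lemma vfB (X : vector_field) f g : X (f - g) = X f - X g.
Proof. by rewrite vfD vfN. Qed.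

Lemma vfZ (X : vector_field) z f :
  X (const_smooth z * f) = const_smooth z * X f.
Proof. by have := vf_linear X z f 0; rewrite vf0 !addr0. Qed.

HB.instance Definition _ := gen_eqMixin vector_field.
HB.instance Definition _ := gen_choiceMixin vector_field.

Program Definition vf_zero : vector_field := @VectorField (fun=> 0) _ _.
Next Obligation. by move=> z f g /=; rewrite mulr0 addr0. Qed.
Next Obligation. by move=> f g /=; rewrite mulr0 mul0r addr0. Qed.

Program Definition vf_add (X Y : vector_field) : vector_field :=
  @VectorField (fun f => X f + Y f) _ _.
Next Obligation. by move=> X Y z f g /=; rewrite !vf_linear; ring. Qed.
Next Obligation. by move=> X Y f g /=; rewrite !vf_leibniz; ring. Qed.

Program Definition vf_opp (X : vector_field) : vector_field :=
  @VectorField (fun f => - X f) _ _.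
Next Obligation. by move=> X z f g /=; rewrite !vf_linear; ring. Qed.
Next Obligation. by move=> X f g /=; rewrite !vf_leibniz; ring. Qed.

Program Definition vf_scale (a : A) (X : vector_field) : vector_field :=
  @VectorField (fun f => a * X f) _ _.
Next Obligation. by move=> a X z f g /=; rewrite !vf_linear; ring. Qed.
Next Obligation. by move=> a X f g /=; rewrite !vf_leibniz; ring. Qed.

Program Definition vf_zmodMixin := @GRing.isZmodule.Build vector_field
  vf_zero vf_opp vf_add _ _ _ _.
Next Obligation. by move=> X Y Z; apply: vf_ext => f /=; rewrite addrA. Qed.
Next Obligation. by move=> X Y; apply: vf_ext => f /=; rewrite addrC. Qed.
Next Obligation. by move=> X; apply: vf_ext => f /=; rewrite add0r. Qed.
Next Obligation. by move=> X; apply: vf_ext => f /=; rewrite addNr. Qed.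
HB.instance Definition _ := vf_zmodMixin.

Program Definition vf_lmodMixin := @GRing.Zmodule_isLmodule.Build A vector_field
  vf_scale _ _ _ _.
Next Obligation. by move=> a b X; apply: vf_ext => f /=; rewrite mulrA. Qed.
Next Obligation. by move=> X; apply: vf_ext => f /=; rewrite mul1r. Qed.
Next Obligation. by move=> a X Y; apply: vf_ext => f /=; rewrite mulrDr. Qed.
Next Obligation. by move=> X a b; apply: vf_ext => f /=; rewrite mulrDl. Qed.
HB.instance Definition _ := vf_lmodMixin.

Lemma vf_addE (X Y : vector_field) f : (X + Y) f = X f + Y f.
Proof. by []. Qed.

Lemma vf_scaleE (a : A) (X : vector_field) f : (a *: X) f = a * X f.
Proof. by []. Qed.

Program Definition bracket (X Y : vector_field) : vector_field :=
  @VectorField (fun f => X (Y f) - Y (X f)) _ _.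
Next Obligation. by move=> X Y z f g /=; rewrite !vf_linear; ring. Qed.
Next Obligation.
by move=> X Y f g /=; rewrite !vf_leibniz !vfD !vf_leibniz; ring.
Qed.

Lemma bracketDr (X Y Z : vector_field) :
  bracket X (Y + Z) = bracket X Y + bracket X Z.
Proof. by apply: vf_ext => f /=; rewrite vfD; ring. Qed.

Lemma bracketDl (X Y Z : vector_field) :
  bracket (X + Y) Z = bracket X Z + bracket Y Z.
Proof. by apply: vf_ext => f /=; rewrite vfD; ring. Qed.

Lemma bracketZr (a : A) (X Y : vector_field) :
  bracket X (a *: Y) = X a *: Y + a *: bracket X Y.
Proof. by apply: vf_ext => f /=; rewrite vf_leibniz; ring. Qed.

Lemma bracketZl (a : A) (X Y : vector_field) :
  bracket (a *: X) Y = a *: bracket X Y - Y a *: X.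
Proof. by apply: vf_ext => f /=; rewrite vf_leibniz; ring. Qed.

Lemma bracketNC (X Y : vector_field) : bracket X Y = - bracket Y X.
Proof. by apply: vf_ext => f /=; ring. Qed.

Lemma bracketXX (X : vector_field) : bracket X X = 0.
Proof. by apply: vf_ext => f /=; ring. Qed.

(* Smooth complex-valued 1-forms and 2-forms, identified with the alternating
   multilinear maps on vector fields over the ring of smooth functions.  Since 2
   is invertible, antisymmetry is the same as alternation, and linearity in the
   second argument follows. *)
Record form1 := Form1 {
  form1_fun :> vector_field -> A;
  form1_linear : forall a X Y,
    form1_fun (a *: X + Y) = a * form1_fun X + form1_fun Y
}.

Record form2 := Form2 {
  form2_fun :> vector_field -> vector_field -> A;
  form2_linear : forall a X Y Z,
    form2_fun (a *: X + Y) Z = a * form2_fun X Z + form2_fun Y Z;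
  form2_antisym : forall X Y, form2_fun X Y = - form2_fun Y X
}.

Lemma form1_ext (u v : form1) : u =1 v -> u = v.
Proof.
case: u v => [u u1] [v v1] /= /funext uv; rewrite uv in u1 *.
by congr Form1; exact: Prop_irrelevance.
Qed.

Lemma form2_ext (u v : form2) : u =2 v -> u = v.
Proof.
case: u v => [u u1 u2] [v v1 v2] /= uv'; have uv : u = v by apply/funext => X; apply/funext => Y; exact: uv'.
  rewrite uv in u1 u2 *.
by congr Form2; exact: Prop_irrelevance.
Qed.

HB.instance Definition _ := gen_eqMixin form1.
HB.instance Definition _ := gen_choiceMixin form1.
HB.instance Definition _ := gen_eqMixin form2.
HB.instance Definition _ := gen_choiceMixin form2.

Section form1_module.

Program Definition form1_zero : form1 := @Form1 (fun=> 0) _.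
Next Obligation. by move=> a X Y /=; ring. Qed.

Program Definition form1_add (u v : form1) : form1 :=
  @Form1 (fun X => u X + v X) _.
Next Obligation. by move=> u v a X Y /=; rewrite !form1_linear; ring. Qed.

Program Definition form1_opp (u : form1) : form1 := @Form1 (fun X => - u X) _.
Next Obligation. by move=> u a X Y /=; rewrite !form1_linear; ring. Qed.

Program Definition form1_scale (a : A) (u : form1) : form1 :=
  @Form1 (fun X => a * u X) _.
Next Obligation. by move=> a u b X Y /=; rewrite !form1_linear; ring. Qed.

Program Definition form1_zmodMixin := @GRing.isZmodule.Build form1
  form1_zero form1_opp form1_add _ _ _ _.
Next Obligation. by move=> u v w; apply: form1_ext => X /=; rewrite addrA. Qed.
Next Obligation. by move=> u v; apply: form1_ext => X /=; rewrite addrC. Qed.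
Next Obligation. by move=> u; apply: form1_ext => X /=; rewrite add0r. Qed.
Next Obligation. by move=> u; apply: form1_ext => X /=; rewrite addNr. Qed.
HB.instance Definition _ := form1_zmodMixin.

Program Definition form1_lmodMixin := @GRing.Zmodule_isLmodule.Build A form1
  form1_scale _ _ _ _.
Next Obligation. by move=> a b u; apply: form1_ext => X /=; rewrite mulrA. Qed.
Next Obligation. by move=> u; apply: form1_ext => X /=; rewrite mul1r. Qed.
Next Obligation. by move=> a u v; apply: form1_ext => X /=; rewrite mulrDr. Qed.
Next Obligation. by move=> u a b; apply: form1_ext => X /=; rewrite mulrDl. Qed.
HB.instance Definition _ := form1_lmodMixin.

End form1_module.

Section form2_module.

Program Definition form2_zero : form2 := @Form2 (fun _ _ => 0) _ _.
Next Obligation. by move=> a X Y Z /=; ring. Qed.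
Next Obligation. by move=> X Y /=; rewrite oppr0. Qed.

Program Definition form2_add (u v : form2) : form2 :=
  @Form2 (fun X Y => u X Y + v X Y) _ _.
Next Obligation. by move=> u v a X Y Z /=; rewrite !form2_linear; ring. Qed.
Next Obligation. by move=> u v X Y /=; rewrite (form2_antisym u) (form2_antisym v); ring. Qed.

Program Definition form2_opp (u : form2) : form2 :=
  @Form2 (fun X Y => - u X Y) _ _.
Next Obligation. by move=> u a X Y Z /=; rewrite !form2_linear; ring. Qed.
Next Obligation. by move=> u X Y /=; rewrite (form2_antisym u). Qed.

Program Definition form2_scale (a : A) (u : form2) : form2 :=
  @Form2 (fun X Y => a * u X Y) _ _.
Next Obligation. by move=> a u b X Y Z /=; rewrite !form2_linear; ring. Qed.
Next Obligation. by move=> a u X Y /=; rewrite (form2_antisym u) mulrN. Qed.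

Program Definition form2_zmodMixin := @GRing.isZmodule.Build form2
  form2_zero form2_opp form2_add _ _ _ _.
Next Obligation.
by move=> u v w; apply: form2_ext => X Y /=; rewrite addrA.
Qed.
Next Obligation. by move=> u v; apply: form2_ext => X Y /=; rewrite addrC. Qed.
Next Obligation. by move=> u; apply: form2_ext => X Y /=; rewrite add0r. Qed.
Next Obligation. by move=> u; apply: form2_ext => X Y /=; rewrite addNr. Qed.
HB.instance Definition _ := form2_zmodMixin.

Program Definition form2_lmodMixin := @GRing.Zmodule_isLmodule.Build A form2
  form2_scale _ _ _ _.
Next Obligation.
by move=> a b u; apply: form2_ext => X Y /=; rewrite mulrA.
Qed.
Next Obligation. by move=> u; apply: form2_ext => X Y /=; rewrite mul1r. Qed.
Next Obligation.
by move=> a u v; apply: form2_ext => X Y /=; rewrite mulrDr.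
Qed.
Next Obligation.
by move=> u a b; apply: form2_ext => X Y /=; rewrite mulrDl.
Qed.
HB.instance Definition _ := form2_lmodMixin.

End form2_module.

Lemma form1D (u : form1) X Y : u (X + Y) = u X + u Y.
Proof. by have := form1_linear u 1 X Y; rewrite scale1r mul1r. Qed.

Lemma form10 (u : form1) : u 0 = 0.
Proof. by apply: (@addrI _ (u 0)); rewrite -form1D !addr0. Qed.

Lemma form1Z (u : form1) a X : u (a *: X) = a * u X.
Proof. by have := form1_linear u a X 0; rewrite form10 !addr0. Qed.

Lemma form1N (u : form1) X : u (- X) = - u X.
Proof. by rewrite -scaleN1r form1Z mulN1r. Qed.

Lemma form2Dl (w : form2) X Y Z : w (X + Y) Z = w X Z + w Y Z.
Proof. by have := form2_linear w 1 X Y Z; rewrite scale1r mul1r. Qed.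

Lemma form20l (w : form2) Z : w 0 Z = 0.
Proof. by apply: (@addrI _ (w 0 Z)); rewrite -form2Dl !addr0. Qed.

Lemma form2Zl (w : form2) a X Z : w (a *: X) Z = a * w X Z.
Proof. by have := form2_linear w a X 0 Z; rewrite form20l !addr0. Qed.

Lemma form2Nl (w : form2) X Z : w (- X) Z = - w X Z.
Proof. by rewrite -scaleN1r form2Zl mulN1r. Qed.

Lemma form2Dr (w : form2) X Y Z : w Z (X + Y) = w Z X + w Z Y.
Proof.
rewrite form2_antisym form2Dl (form2_antisym w X) (form2_antisym w Y); ring.
Qed.

Lemma form2Zr (w : form2) a X Z : w Z (a *: X) = a * w Z X.
Proof. by rewrite form2_antisym form2Zl (form2_antisym w X) mulrN opprK. Qed.

Lemma form2Nr (w : form2) X Z : w Z (- X) = - w Z X.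
Proof. by rewrite -scaleN1r form2Zr mulN1r. Qed.

Program Definition interior_product (X : vector_field) (w : form2) : form1 :=
  @Form1 (fun Y => w X Y) _.
Next Obligation. by move=> X w a Y Z /=; rewrite form2Dr form2Zr. Qed.

(* Koszul's formulas, normalized so that (df /\ dg)(X, Y) = Xf Yg - Xg Yf. *)
Program Definition ext_deriv1 (u : form1) : form2 :=
  @Form2 (fun X Y => X (u Y) - Y (u X) - u (bracket X Y)) _ _.
Next Obligation.
move=> u a X Y Z /=; rewrite bracketDl bracketZl !(form1D, form1N, form1Z).
by rewrite vfD vf_leibniz; ring.
Qed.
Next Obligation. by move=> u X Y /=; rewrite bracketNC form1N; ring. Qed.

Definition ext_deriv2 (w : form2) (X Y Z : vector_field) : A :=
  X (w Y Z) - Y (w X Z) + Z (w X Y)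
  - w (bracket X Y) Z + w (bracket X Z) Y - w (bracket Y Z) X.

Program Definition lie_deriv (X : vector_field) (w : form2) : form2 :=
  @Form2 (fun Y Z => X (w Y Z) - w (bracket X Y) Z - w Y (bracket X Z)) _ _.
Next Obligation.
move=> X w a Y W Z /=; rewrite bracketDr bracketZr.
rewrite !(form2Dl, form2Zl) vfD vf_leibniz; ring.
Qed.
Next Obligation.
move=> X w Y Z /=; rewrite (form2_antisym w Y) vfN.
by rewrite (form2_antisym w Y (bracket _ _)) (form2_antisym w (bracket _ _) Z);
  ring.
Qed.

Lemma const_smoothV z : conj_smooth (const_smooth z) = const_smooth z^*%C.
Proof. exact/val_inj. Qed.

Lemma conj_smoothD f g : conj_smooth (f + g) = conj_smooth f + conj_smooth g.
Proof. by apply/val_inj/funext => p; exact: (rmorphD (@conjc R)). Qed.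

Lemma conj_smoothN f : conj_smooth (- f) = - conj_smooth f.
Proof. by apply/val_inj/funext => p; exact: (rmorphN (@conjc R)). Qed.

Lemma conj_smoothM f g : conj_smooth (f * g) = conj_smooth f * conj_smooth g.
Proof. by apply/val_inj/funext => p; exact: (rmorphM (@conjc R)). Qed.

Lemma conj_smoothK : involutive conj_smooth.
Proof. by move=> f; apply/val_inj/funext => p; exact: conjcK. Qed.

Program Definition conj_vf (X : vector_field) : vector_field :=
  @VectorField (fun f => conj_smooth (X (conj_smooth f))) _ _.
Next Obligation.
move=> X z f g /=; rewrite conj_smoothD conj_smoothM const_smoothV vf_linear.
by rewrite conj_smoothD conj_smoothM const_smoothV conjcK.
Qed.
Next Obligation.
move=> X f g /=; rewrite conj_smoothM vf_leibniz conj_smoothD !conj_smoothM.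
by rewrite !conj_smoothK.
Qed.

Lemma conj_vfD X Y : conj_vf (X + Y) = conj_vf X + conj_vf Y.
Proof. by apply: vf_ext => f /=; exact: conj_smoothD. Qed.

Lemma conj_vfZ a X : conj_vf (a *: X) = conj_smooth a *: conj_vf X.
Proof. by apply: vf_ext => f /=; exact: conj_smoothM. Qed.

Program Definition conj_form2 (w : form2) : form2 :=
  @Form2 (fun X Y => conj_smooth (w (conj_vf X) (conj_vf Y))) _ _.
Next Obligation.
move=> w a X Y Z /=; rewrite conj_vfD conj_vfZ form2_linear conj_smoothD.
by rewrite conj_smoothM conj_smoothK.
Qed.
Next Obligation.
by move=> w X Y /=; rewrite form2_antisym conj_smoothN.
Qed.

Definition real_vf (X : vector_field) : Prop := conj_vf X = X.

Definition real_form2 (w : form2) : Prop := conj_form2 w = w.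

Definition vf_nonzero_at (X : vector_field) (p : M) : Prop :=
  exists f : A, X f p != 0.

Definition flat (w : form2) (X : vector_field) : form1 := interior_product X w.

Definition nondegenerate_form2 (w : form2) : Prop := bijective (flat w).

(* The inverse of [flat w] when w is nondegenerate; a junk value otherwise. *)
Definition sharp (w : form2) (u : form1) : vector_field :=
  xget 0 [set X | flat w X = u].

Definition closed_form2 (w : form2) : Prop :=
  forall X Y Z, ext_deriv2 w X Y Z = 0.

Definition symplectic (w : form2) : Prop :=
  [/\ real_form2 w, closed_form2 w & nondegenerate_form2 w].

(* A Riemannian metric, extended bilinearly to complex vector fields. *)
Record riemannian_metric := RiemannianMetric {
  metric_fun :> vector_field -> vector_field -> A;
  metric_linear : forall a X Y Z,
    metric_fun (a *: X + Y) Z = a * metric_fun X Z + metric_fun Y Z;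
  metric_sym : forall X Y, metric_fun X Y = metric_fun Y X;
  metric_real : forall X Y,
    metric_fun (conj_vf X) (conj_vf Y) = conj_smooth (metric_fun X Y);
  (* The order of R[i] makes this say that the value is real and positive. *)
  metric_pos : forall X p, real_vf X -> vf_nonzero_at X p ->
    0 < metric_fun X X p
}.

End calculus.

Section hyperkahler.
Variables (R : realType) (m : nat).

(* v^{-1} w, for 2-forms seen as bundle maps from TM to T*M. *)
Definition quotient_endo n (M : smooth_manifold R n) (v w : form2 M) :
  vector_field M -> vector_field M := sharp v \o flat w.

Record hyperkahler (M : smooth_manifold R (4 * m)%N) := Hyperkahler {
  omega1 : form2 M;
  omega2 : form2 M;
  omega3 : form2 M;
  omega1_symplectic : symplectic omega1;
  omega2_symplectic : symplectic omega2;
  omega3_symplectic : symplectic omega3;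
  I1 := quotient_endo omega3 omega2;
  I2 := quotient_endo omega1 omega3;
  I3 := quotient_endo omega2 omega1;
  I1_sqr : forall X, I1 (I1 X) = - X;
  I2_sqr : forall X, I2 (I2 X) = - X;
  I3_sqr : forall X, I3 (I3 X) = - X;
  I123 : forall X, I1 (I2 (I3 X)) = - X;
  hk_metric : riemannian_metric M;
  omega1E : forall X Y, omega1 X Y = hk_metric X (I1 Y);
  omega2E : forall X Y, omega2 X Y = hk_metric X (I2 Y);
  omega3E : forall X Y, omega3 X Y = hk_metric X (I3 Y)
}.

Variables (M : smooth_manifold R (4 * m)%N) (H : hyperkahler M).
Local Notation C := R[i].
Local Notation V := (vector_field M).
Local Notation "z %:S" := (const_smooth M (z : C)) (at level 2, format "z %:S").

Definition I_plus (X : V) : V := (2^-1)%:S *: (I1 H X + 'i%C%:S *: I2 H X).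
Definition I_zero (X : V) : V := I3 H X.
Definition I_minus (X : V) : V := - ((2^-1)%:S *: (I1 H X - 'i%C%:S *: I2 H X)).

Definition omega_plus : form2 M := (2^-1)%:S *: (omega1 H + 'i%C%:S *: omega2 H).
Definition omega_zero : form2 M := omega3 H.
Definition omega_minus : form2 M :=
  - ((2^-1)%:S *: (omega1 H - 'i%C%:S *: omega2 H)).

Definition omega (n : int) : form2 M :=
  if n == 1 then omega_plus else if n == 0 then omega_zero
  else if n == -1 then omega_minus else 0.

(* The reality condition: the conjugate of X_n is (-1)^n X_{-n}. *)
Definition conj_alternating (X : int -> V) : Prop :=
  forall n, conj_vf (X n) = ((-1) ^ n)%:S *: X (- n).

Definition supported_on (X : int -> V) (a b : int) : Prop :=
  forall n, ~~ (a <= n <= b) -> X n = 0.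

(* Generators of an O(2j-2)-twisted rotational action relative to the 3-axis. *)
Definition twisted_rotational_action (j : int) (X : int -> V) : Prop :=
  [/\ supported_on X (1 - j) (j - 1),
      conj_alternating X &
      forall n : int,
        lie_deriv (X (n - 1)) omega_plus + lie_deriv (X n) omega_zero
        + lie_deriv (X (n + 1)) omega_minus
        = (- 'i%C * n%:~R)%:S *: omega n].

(* X' is obtained from X by one of the allowed redefinitions of generators. *)
Definition equivalent_generators (j : int) (X X' : int -> V) : Prop :=
  exists Y : int -> V,
    [/\ supported_on Y (2 - j) (j - 2),
        conj_alternating Y &
        forall n, X' n =
          X n + I_plus (Y (n - 1)) + I_zero (Y n) + I_minus (Y (n + 1))].

(* Sections of T^{1,0} and T^{0,1} for the complex structure I_0: the
   eigenspaces of I_0 for the eigenvalues i and -i. *)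
Definition type10 (X : V) : Prop := I_zero X = 'i%C%:S *: X.
Definition type01 (X : V) : Prop := I_zero X = (- 'i%C)%:S *: X.

(* The (2,0) and (0,2) components vanish. *)
Definition form_type11 (s : form2 M) : Prop :=
  (forall X Y, type10 X -> type10 Y -> s X Y = 0) /\
  (forall X Y, type01 X -> type01 Y -> s X Y = 0).

Definition canonical_presentation (j : int) (X Xs : int -> V) : Prop :=
  [/\ twisted_rotational_action j Xs,
      equivalent_generators j X Xs,
      forall n, 0 < n -> type10 (Xs n) &
      forall n, n < 0 -> type01 (Xs n)].

(* X is quasi-rotational relative to the 3-axis, as witnessed by s_plus. *)
Definition quasi_rotational_with (X : V) (s_plus : form2 M) : Prop :=
  let s_minus := - conj_form2 s_plus in
  [/\ real_vf X, form_type11 s_plus,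
      lie_deriv X omega_plus = (- 'i%C)%:S *: (omega_plus - s_plus),
      lie_deriv X omega_minus = 'i%C%:S *: (omega_minus - s_minus) &
      lie_deriv X omega_zero = 0].

Definition quasi_rotational (X : V) : Prop :=
  exists s_plus, quasi_rotational_with X s_plus.

End hyperkahler.

(* Main.v *)
Require Import Defs.
From HB Require Import structures.
From mathcomp Require Import all_boot all_order all_algebra.
From mathcomp Require Import all_classical all_reals all_analysis.
From mathcomp Require Import complex.
From mathcomp Require Import ring.
Import Order.TTheory GRing.Theory Num.Theory.
Local Open Scope ring_scope.

Set Implicit Arguments.
Unset Strict Implicit.
Unset Printing Implicit Defensive.

(** The types with respect to [I_zero] are governed by two closed forms: a
    vector field has type (1,0) exactly when it is in the kernel of
    [omega_minus] ([type10P]), and those of type (0,1) are in the kernel of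
    [omega_plus] ([type01_ker_omega_plus]).

    The kernel of a closed 2-form consists of symmetries of that form
    ([lie_deriv_ker]).  In a canonical presentation this removes the outer terms
    of the defining equations: for n = 1 the term in [omega_minus] vanishes, since
    X_2 has type (1,0), and what remains is
    L_{X_0} omega_+ + L_{X_1} omega_0 = - i omega_+, which is the
    quasi-rotational equation with sigma_+ = i L_{X_1} omega_0; for n = 0 both
    outer terms vanish, which leaves L_{X_0} omega_0 = 0.  The equation for
    [omega_minus] is the complex conjugate of the one for [omega_plus], because
    X_0 is real.

    The form sigma_+ has type (1,1) for two different reasons.  On fields
    of type (1,0), the form [omega_zero] vanishes, and X_1 preserves the type
    (1,0) since the kernel of the closed form [omega_minus] is involutive; so
    L_{X_1} omega_0 vanishes there.  On fields of type (0,1), the equation for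
    n = 1 expresses it through [omega_plus] and L_{X_0} omega_+, both of which
    vanish there because [omega_plus] annihilates these fields.  Cartan's formula
    [cartan_closed] gives the second expression of sigma_+. *)

(** * Constants in the ring of smooth functions *)

Section smooth_constants.
Variables (R : realType) (n : nat) (M : smooth_manifold R n).
Local Notation C := R[i].

Lemma const_smoothD (z w : C) :
  const_smooth M (z + w) = const_smooth M z + const_smooth M w.
Proof. exact/val_inj. Qed.

Lemma const_smoothN (z : C) : const_smooth M (- z) = - const_smooth M z.
Proof. exact/val_inj. Qed.

Lemma conjC_i : ('i%C : C)^*%C = - 'i%C.
Proof. by apply/eqP; rewrite eq_complex /= oppr0 !eqxx. Qed.

Lemma const_smoothM (z w : C) :
  const_smooth M (z * w) = const_smooth M z * const_smooth M w.
Proof. exact/val_inj. Qed.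

Lemma const_smooth_i_sqr : const_smooth M 'i%C * const_smooth M 'i%C = -1.
Proof.
by rewrite -const_smoothM -expr2 sqr_i const_smoothN const_smooth1.
Qed.

Lemma const_smooth_half : const_smooth M (2^-1) + const_smooth M (2^-1) = 1.
Proof.
rewrite -const_smoothD -const_smooth1; congr const_smooth.
by rewrite -mulr2n -[LHS]mulr_natr mulVf// pnatr_eq0.
Qed.

Lemma smooth_eqN_eq0 (f : smooth_function M) : f = - f -> f = 0.
Proof.
move=> fN; rewrite -[f]mul1r -const_smooth_half mulrDl.
by rewrite [X in _ + _ * X]fN mulrN subrr.
Qed.

End smooth_constants.

(** * Closed 2-forms, Lie derivatives and conjugation *)

Section form_calculus.
Variables (R : realType) (n : nat) (M : smooth_manifold R n).
Implicit Types (v w : form2 M) (X Y Z : vector_field M).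

Lemma form2_addE v w X Y : (v + w) X Y = v X Y + w X Y.
Proof. by []. Qed.

Lemma form2_oppE w X Y : (- w) X Y = - w X Y.
Proof. by []. Qed.

Lemma form2_scaleE (a : smooth_function M) w X Y : (a *: w) X Y = a * w X Y.
Proof. by []. Qed.

Lemma lie_derivE X w Y Z :
  lie_deriv X w Y Z = X (w Y Z) - w (bracket X Y) Z - w Y (bracket X Z).
Proof. by []. Qed.

Definition form2E := (form2_addE, form2_oppE, form2_scaleE).

Lemma closed_form2D v w :
  closed_form2 v -> closed_form2 w -> closed_form2 (v + w).
Proof.
move=> cv cw X Y Z; rewrite -[RHS](addr0 0) -{1}(cv X Y Z) -(cw X Y Z).
by rewrite /ext_deriv2 !form2E !vfD; ring.
Qed.

Lemma closed_form2Z (z : R[i]) w :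
  closed_form2 w -> closed_form2 (const_smooth M z *: w).
Proof.
move=> cw X Y Z; rewrite -(mulr0 (const_smooth M z)) -(cw X Y Z).
rewrite /ext_deriv2 !form2E !vfZ; ring.
Qed.

Lemma closed_form2N w : closed_form2 w -> closed_form2 (- w).
Proof.
move=> cw; rewrite -scaleN1r -const_smooth1 -const_smoothN.
exact: closed_form2Z.
Qed.

(** In Cartan's formula, L_X = d i_X + i_X d, the second term drops out on a
    closed form. *)
Lemma cartan_closed X w :
  closed_form2 w -> lie_deriv X w = ext_deriv1 (interior_product X w).
Proof.
move=> cw; apply: form2_ext => Y Z; apply/subr0_eq.
rewrite -(cw X Y Z) /ext_deriv2 /=.
rewrite (form2_antisym w Y (bracket X Z)) (form2_antisym w (bracket Y Z) X).
by ring.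
Qed.

(** A consequence of Cartan's formula: i_X w = 0 leaves d (i_X w) = 0. *)
Lemma lie_deriv_ker X w :
  closed_form2 w -> (forall Y, w X Y = 0) -> lie_deriv X w = 0.
Proof.
move=> cw wX; rewrite cartan_closed//; apply: form2_ext => Y Z /=.
by rewrite !wX !vf0 !subr0.
Qed.

(** The Frobenius condition for the kernel of a closed form: in dw (X, Y, Z)
    only the term in w ([X, Y], Z) survives. *)
Lemma bracket_ker X Y w : closed_form2 w ->
  (forall Z, w X Z = 0) -> (forall Z, w Y Z = 0) ->
  forall Z, w (bracket X Y) Z = 0.
Proof.
move=> cw wX wY Z; have := cw X Y Z; rewrite /ext_deriv2.
rewrite (form2_antisym w (bracket X Z)) (form2_antisym w (bracket Y Z)).
rewrite !wX !wY !vf0.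
by rewrite !(addr0, subr0, sub0r, oppr0) => /eqP; rewrite oppr_eq0 => /eqP.
Qed.

Lemma conj_vfK X : conj_vf (conj_vf X) = X.
Proof. by apply: vf_ext => f /=; rewrite !conj_smoothK. Qed.

Lemma conj_bracket X Y :
  conj_vf (bracket X Y) = bracket (conj_vf X) (conj_vf Y).
Proof.
by apply: vf_ext => f /=; rewrite conj_smoothD conj_smoothN !conj_smoothK.
Qed.

Lemma conj_form2D v w : conj_form2 (v + w) = conj_form2 v + conj_form2 w.
Proof. by apply: form2_ext => X Y; exact: conj_smoothD. Qed.

Lemma conj_form2N w : conj_form2 (- w) = - conj_form2 w.
Proof. by apply: form2_ext => X Y; exact: conj_smoothN. Qed.

Lemma conj_form2Z (z : R[i]) w :
  conj_form2 (const_smooth M z *: w) = const_smooth M (z^*)%C *: conj_form2 w.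
Proof.
by apply: form2_ext => X Y; rewrite /= conj_smoothM const_smoothV.
Qed.

Lemma conj_lie_deriv X w :
  conj_form2 (lie_deriv X w) = lie_deriv (conj_vf X) (conj_form2 w).
Proof.
apply: form2_ext => Y Z /=.
by rewrite !conj_bracket !conj_vfK !(conj_smoothD, conj_smoothN) !conj_smoothK.
Qed.

Lemma lie_derivN X w : lie_deriv X (- w) = - lie_deriv X w.
Proof. by apply: form2_ext => Y Z; rewrite !form2E /= vfN; ring. Qed.

Lemma flat_sharp w (u : form1 M) : nondegenerate_form2 w -> flat w (sharp w u) = u.
Proof.
move=> [g _ gK]; rewrite /sharp.
have : exists X, [set X | flat w X = u]%classic X by exists (g u); exact: gK.
by move=> /(xgetPex 0).
Qed.

End form_calculus.

(** * Types with respect to the third complex structure *)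

Section hyperkahler_types.
Variables (R : realType) (m : nat) (M : smooth_manifold R (4 * m)%N).
Variable H : hyperkahler M.
Implicit Types X Y Z : vector_field M.
Local Notation "z %:S" := (const_smooth M (z : R[i])) (at level 2, format "z %:S").

Lemma omega_plusE X Y :
  omega_plus H X Y = (2^-1)%:S * (omega1 H X Y + 'i%C%:S * omega2 H X Y).
Proof. by []. Qed.

Lemma omega_minusE X Y :
  omega_minus H X Y = - ((2^-1)%:S * (omega1 H X Y - 'i%C%:S * omega2 H X Y)).
Proof. by []. Qed.

Lemma omega2_I_zero X Y : omega2 H (I_zero H X) Y = omega1 H X Y.
Proof.
have [_ _ nd2] := omega2_symplectic H.
by have /(congr1 (fun u : form1 M => u Y)) := flat_sharp (flat (omega1 H) X) nd2.
Qed.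

(** Since omega_1 = omega_2 (I_0 -, -), the equation omega_- (X, -) = 0 reads
    omega_2 (I_0 X - i X, -) = 0, and omega_2 is nondegenerate. *)
Lemma type10P X : type10 H X <-> forall Y, omega_minus H X Y = 0.
Proof.
split=> [X10 Y|wX].
  by rewrite omega_minusE -omega2_I_zero X10 form2Zl subrr mulr0 oppr0.
have [_ _ nd2] := omega2_symplectic H; apply: (bij_inj nd2).
apply: form1_ext => Y; rewrite /flat /= omega2_I_zero form2Zl; apply/subr0_eq.
have /eqP := wX Y; rewrite omega_minusE oppr_eq0 => /eqP w0.
by rewrite -[LHS]mul1r -(const_smooth_half M) mulrDl w0 addr0.
Qed.

Lemma type01_ker_omega_plus X : type01 H X -> forall Y, omega_plus H X Y = 0.
Proof.
move=> X01 Y; rewrite omega_plusE -omega2_I_zero X01 form2Zl const_smoothN.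
by ring.
Qed.

Lemma closed_omega_plus : closed_form2 (omega_plus H).
Proof.
have [_ c1 _] := omega1_symplectic H; have [_ c2 _] := omega2_symplectic H.
by apply: closed_form2Z; apply: closed_form2D => //; exact: closed_form2Z.
Qed.

Lemma closed_omega_minus : closed_form2 (omega_minus H).
Proof.
have [_ c1 _] := omega1_symplectic H; have [_ c2 _] := omega2_symplectic H.
apply/closed_form2N/closed_form2Z/closed_form2D => //.
exact/closed_form2N/closed_form2Z.
Qed.

Lemma conj_omega_plus : conj_form2 (omega_plus H) = - omega_minus H.
Proof.
have [r1 _ _] := omega1_symplectic H; have [r2 _ _] := omega2_symplectic H.
rewrite /omega_plus /omega_minus opprK conj_form2Z conj_form2D conj_form2Z.
rewrite r1 r2 conjc_inv conjc_nat.
by rewrite conjC_i const_smoothN scaleNr.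
Qed.

(** Integrability of I_0, obtained from the closedness of [omega_minus]. *)
Lemma type10_bracket X Y :
  type10 H X -> type10 H Y -> type10 H (bracket X Y).
Proof.
move=> /type10P wX /type10P wY; apply/type10P.
exact: bracket_ker closed_omega_minus wX wY.
Qed.

(** For fields of type (1,0), omega_0 (X, Y) = g (X, I_0 Y) = i g (X, Y) is both
    symmetric and antisymmetric. *)
Lemma omega_zero_type10 X Y :
  type10 H X -> type10 H Y -> omega_zero H X Y = 0.
Proof.
move=> X10 Y10; apply: smooth_eqN_eq0; rewrite -form2_antisym.
rewrite [LHS]omega3E [RHS]omega3E -/(I_zero H X) -/(I_zero H Y) X10 Y10.
rewrite (Defs.metric_sym _ X) (Defs.metric_sym _ Y).
have metricZ (a : smooth_function M) U W :
    hk_metric H (a *: U) W = a * hk_metric H U W.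
  have g0 : hk_metric H 0 W = 0.
    apply: (@addrI _ (hk_metric H 0 W)); rewrite addr0.
    have := Defs.metric_linear (hk_metric H) 1 0 0 W.
    by rewrite scaler0 addr0 mul1r.
  by have := Defs.metric_linear (hk_metric H) a U 0 W; rewrite g0 !addr0.
by rewrite !metricZ (Defs.metric_sym _ Y).
Qed.

Lemma lie_deriv_omega_zero_type10 X Y Z :
  type10 H X -> type10 H Y -> type10 H Z ->
  lie_deriv X (omega_zero H) Y Z = 0.
Proof.
move=> X10 Y10 Z10.
by rewrite lie_derivE !omega_zero_type10 ?vf0 ?subr0//; exact: type10_bracket.
Qed.

Lemma lie_deriv_omega_plus_type01 X Y Z :
  type01 H Y -> type01 H Z -> lie_deriv X (omega_plus H) Y Z = 0.
Proof.
move=> Y01 Z01; rewrite lie_derivE (form2_antisym _ (bracket X Y)).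
by rewrite !type01_ker_omega_plus// vf0 !oppr0 !addr0.
Qed.

End hyperkahler_types.

(** * The generator of index zero of a canonical presentation *)

Section canonical.
Variables (R : realType) (m : nat) (M : smooth_manifold R (4 * m)%N).
Variables (H : hyperkahler M) (j : int) (Xs : int -> vector_field M).
Hypothesis Xs_action : twisted_rotational_action H j Xs.
Hypothesis Xs10 : forall n, 0 < n -> type10 H (Xs n).
Hypothesis Xs01 : forall n, n < 0 -> type01 H (Xs n).
Local Notation "z %:S" := (const_smooth M (z : R[i])) (at level 2, format "z %:S").

Let sigma : form2 M := 'i%C%:S *: lie_deriv (Xs 1) (omega_zero H).

Lemma lie_deriv_omega_minus_pos n :
  0 < n -> lie_deriv (Xs n) (omega_minus H) = 0.
Proof.
move=> /Xs10/type10P; apply: lie_deriv_ker; exact: closed_omega_minus.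
Qed.

Lemma lie_deriv_omega_plus_neg n :
  n < 0 -> lie_deriv (Xs n) (omega_plus H) = 0.
Proof.
move=> /Xs01/type01_ker_omega_plus; apply: lie_deriv_ker.
exact: closed_omega_plus.
Qed.

Lemma real_Xs0 : real_vf (Xs 0).
Proof.
case: Xs_action => _ /(_ 0) + _; rewrite /real_vf oppr0 => ->.
by rewrite expr0z const_smooth1 scale1r.
Qed.

Lemma twisted_eq1 :
  lie_deriv (Xs 0) (omega_plus H) + lie_deriv (Xs 1) (omega_zero H)
  = (- 'i%C)%:S *: omega_plus H.
Proof.
case: Xs_action => _ _ /(_ 1); rewrite subrr mulr1.
by rewrite lie_deriv_omega_minus_pos// addr0.
Qed.

Lemma lie_deriv_Xs0_omega_zero : lie_deriv (Xs 0) (omega_zero H) = 0.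
Proof.
case: Xs_action => _ _ /(_ 0); rewrite sub0r add0r mulr0.
rewrite lie_deriv_omega_minus_pos// lie_deriv_omega_plus_neg// addr0 add0r => ->.
by rewrite (_ : const_smooth M 0 = 0) ?scale0r//; exact/val_inj.
Qed.

Lemma lie_deriv_Xs0_omega_plus :
  lie_deriv (Xs 0) (omega_plus H) = (- 'i%C)%:S *: (omega_plus H - sigma).
Proof.
rewrite scalerBr -twisted_eq1 /sigma scalerA const_smoothN mulNr.
by rewrite const_smooth_i_sqr opprK scale1r addrK.
Qed.

(** Complex conjugation exchanges [omega_plus] and - [omega_minus] and fixes the
    real field X_0. *)
Lemma lie_deriv_Xs0_omega_minus :
  lie_deriv (Xs 0) (omega_minus H)
  = 'i%C%:S *: (omega_minus H - - conj_form2 sigma).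
Proof.
have := congr1 (@conj_form2 _ _ _) lie_deriv_Xs0_omega_plus.
rewrite conj_lie_deriv real_Xs0 conj_form2Z conj_form2D conj_form2N.
rewrite conj_omega_plus lie_derivN => /(congr1 -%R); rewrite opprK => ->.
by rewrite -scalerN opprB -conjC_i conjcK !opprK addrC.
Qed.

(** The (2,0) part vanishes because X_1 preserves the type (1,0), the (0,2) part
    because, by [twisted_eq1], sigma is a combination of [omega_plus] and its Lie
    derivative along X_0. *)
Lemma sigma_type11 : form_type11 H sigma.
Proof.
split=> Y Z hY hZ; rewrite form2E.
  by rewrite lie_deriv_omega_zero_type10// ?mulr0//; exact: Xs10.
have /(canRL (addKr _)) -> := twisted_eq1.
rewrite form2_addE form2_oppE form2_scaleE.
by rewrite lie_deriv_omega_plus_type01// type01_ker_omega_plus//; ring.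
Qed.

Lemma quasi_rotational_Xs0 : quasi_rotational_with H (Xs 0) sigma.
Proof.
split.
- exact: real_Xs0.
- exact: sigma_type11.
- exact: lie_deriv_Xs0_omega_plus.
- exact: lie_deriv_Xs0_omega_minus.
- exact: lie_deriv_Xs0_omega_zero.
Qed.

End canonical.

Theorem proposition27 (R : realType) (m : nat) (M : smooth_manifold R (4 * m)%N)
    (H : hyperkahler M) (j : int) (hj : 1 <= j)
    (X Xs : int -> vector_field M)
    (hX : twisted_rotational_action H j X)
    (hXs : canonical_presentation H j X Xs) :
  quasi_rotational H (Xs 0) /\
  exists sigma_plus : form2 M,
    [/\ quasi_rotational_with H (Xs 0) sigma_plus,
        sigma_plus =
          const_smooth M 'i%C *: lie_deriv (Xs 1) (omega_zero H) &
        sigma_plus =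
          const_smooth M 'i%C *:
            ext_deriv1 (interior_product (Xs 1) (omega_zero H))].
Proof.
have [act _ Xs10 Xs01] := hXs.
have qr := quasi_rotational_Xs0 act Xs10 Xs01.
have [_ closed3 _] := omega3_symplectic H.
split; first by eexists; exact: qr.
exists (const_smooth M 'i%C *: lie_deriv (Xs 1) (omega_zero H)); split=> //.
by rewrite cartan_closed.
Qed.
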